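(* Let $p\in[1,\infty)$, let $\rho\colon[0,\infty)\to[0,\infty)$ be non-decreasing, let $(X,d_X)$ be a metric space and $(Y,\|\cdot\|)$ a Banach space. If $X$ is locally $[\rho(t),t]$-representable into $Y$, then $X$ admits a $[\rho(t),t]$-embedding into $\ell_p(Y)$.
   Context: For functions $g,h\colon\mathbb{R}\to\mathbb{R}$ write $g\ll h$ if there exist $c_1,c_2>0$ and $c_3,c_4\in\mathbb{R}$ such that $g(t)\le c_1h(c_2t+c_3)+c_4$ for every $t$; write $g\asymp h$ if $g\ll h$ and $h\ll g$. A non-decreasing function $h$ on $[0,\infty)$ is regarded as a function on $\mathbb{R}$ by setting $h(t)=h(0)$ for $t<0$. Functions are identified with their $\asymp$-equivalence classes, so that the bracket notions below are understood up to $\asymp$. A map $f\colon(X,d_X)\to(Z,d_Z)$ is a $[\rho,\omega]$-embedding if there are non-decreasing real-valued functions $\tilde\rho\asymp\rho$ and $\tilde\omega\asymp\omega$ on $[0,\infty)$ such that $\tilde\rho(d_X(x,y))\le d_Z(f(x),f(y))\le\tilde\omega(d_X(x,y))$ for all $x,y\in X$. The space $X$ is locally $[\rho,\omega]$-representable into $Z$ if there are non-decreasing real-valued functions $\tilde\rho\asymp\rho$ and $\tilde\omega\asymp\omega$ on $[0,\infty)$ such that for every metric ball $B$ in $X$ there is a map $f_B\colon B\to Z$ with $\tilde\rho(d_X(x,y))\le d_Z(f_B(x),f_B(y))\le\tilde\omega(d_X(x,y))$ for all $x,y\in B$ (the functions $\tilde\rho,\tilde\omega$ do not depend on $B$). In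 $[\rho(t),t]$ the second function is the identity $\omega(t)=t$. $\ell_p(Y)$ is the Banach space of sequences $(y_n)_{n\ge1}$ in $Y$ with $\sum_n\|y_n\|^p<\infty$, with norm $(\sum_n\|y_n\|^p)^{1/p}$. *)

(* Defs.v *)
From HB Require Import structures.
From mathcomp Require Import all_boot all_order all_algebra.
From mathcomp Require Import all_classical all_reals all_analysis.

Set Implicit Arguments.
Unset Strict Implicit.
Unset Printing Implicit Defensive.

Import Order.TTheory GRing.Theory Num.Theory.
Import numFieldNormedType.Exports.

Local Open Scope classical_set_scope.
Local Open Scope ring_scope.

Section Asymp.
Context {R : realType}.
Implicit Types g h : R -> R.

Definition dominated g h := exists c1 c2 c3 c4 : R,
  [/\ 0 < c1, 0 < c2 & forall t, g t <= c1 * h (c2 * t + c3) + c4].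

Definition asymp g h := dominated g h /\ dominated h g.

(* A function on [0, +oo[ is represented by a function on R of which only the
   values at nonnegative reals are ever used. *)
Definition nondecreasing_nneg h := {in Num.nneg &, {homo h : s t / s <= t}}.

Definition extend_cst h : R -> R := fun t => h (Num.max 0 t).

Definition asymp_nneg g h := asymp (extend_cst g) (extend_cst h).

End Asymp.

Section Embeddings.
Context {R : realType} (X Z : metricType R).
Implicit Types rho omega : R -> R.

Definition is_embedding rho omega (f : X -> Z) :=
  exists rho' omega' : R -> R,
    [/\ nondecreasing_nneg rho' /\ asymp_nneg rho' rho,
        nondecreasing_nneg omega' /\ asymp_nneg omega' omega &
        forall x y : X,
          rho' (mdist x y) <= mdist (f x) (f y) <= omega' (mdist x y)].

Definition admits_embedding rho omega :=
  exists f : X -> Z, is_embedding rho omega f.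

Definition metric_ball (B : set X) :=
  exists (a : X) (r : R), 0 < r /\ B = ball a r.

Definition locally_representable rho omega :=
  exists rho' omega' : R -> R,
    [/\ nondecreasing_nneg rho' /\ asymp_nneg rho' rho,
        nondecreasing_nneg omega' /\ asymp_nneg omega' omega &
        forall B : set X, metric_ball B ->
          exists f : B -> Z, forall x y : B,
            rho' (mdist (val x) (val y)) <= mdist (f x) (f y)
              <= omega' (mdist (val x) (val y))].

End Embeddings.

(* The library does not equip normed modules with a [metricType] structure. *)
Definition norm_metric {R : realType} (Y : normedModType R) : Type := Y.

Section NormMetric.
Context {R : realType} (Y : normedModType R).

HB.instance Definition _ := PseudoMetric.copy (norm_metric Y) Y.

Let dist (x y : norm_metric Y) : R := `|(x : Y) - (y : Y)|.

Let dist_ge0 x y : 0 <= dist x y.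
Proof. exact: normr_ge0. Qed.

Let dist_positivity x y : dist x y = 0 -> x = y.
Proof. by move/normr0_eq0/eqP; rewrite subr_eq0 => /eqP. Qed.

Let ballE x d : ball x d = [set y | dist x y < d].
Proof. by rewrite -[LHS]/(ball (x : Y) d) -ball_normE. Qed.

HB.instance Definition _ := PseudoMetric_isMetric.Build R (norm_metric Y)
  dist_ge0 dist_positivity ballE.

Lemma mdist_normE (x y : norm_metric Y) : mdist x y = `|(x : Y) - (y : Y)|.
Proof. by []. Qed.

End NormMetric.

Section LpSeq.
Context {R : realType} (p : R) (Y : normedModType R).
Implicit Types y z : nat -> Y.

Definition lp_summable y := cvgn (series (fun n => `|y n| `^ p)).

Definition lp_norm y : R := limn (series (fun n => `|y n| `^ p)) `^ p^-1.

Context (p1 : 1 <= p).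

Let p0 : 0 < p. Proof. exact: lt_le_trans p1. Qed.

Local Notation N y := (Lnorm counting p%:E (EFin \o (fun n => `|y n|))).

Let NE y : N y = ((\sum_(n <oo) (`|y n| `^ p)%:E) `^ p^-1)%E.
Proof.
rewrite Lnorm_counting//; congr (_ `^ _)%E.
by apply: eq_eseriesr => n _ /=; rewrite normr_id.
Qed.

Let sumE y : lp_summable y ->
  (\sum_(n <oo) (`|y n| `^ p)%:E)%E =
  (limn (series (fun n => `|y n| `^ p)))%:E.
Proof.
move=> cy; rewrite -EFin_lim//.
by apply: congr_lim; apply/funext => n /=; rewrite /series/= -sumEFin.
Qed.

Let lp_normEN y : lp_summable y -> N y = (lp_norm y)%:E.
Proof. by move=> cy; rewrite NE sumE. Qed.

Let lp_summableP y : (N y < +oo)%E -> lp_summable y.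
Proof.
rewrite NE => Ny; apply: nnseries_is_cvg => [n|]; first exact: powR_ge0.
by apply: lty_poweRy Ny; rewrite invr_neq0// gt_eqF.
Qed.

Let NleD y z : (N (y + z)%R <= N y + N z)%E.
Proof.
have mE (u : nat -> R) : measurable_fun setT u by [].
apply: le_trans (minkowski_EFin counting (mE _) (mE _) p1).
rewrite !Lnorm_counting//.
apply: gt0_ler_poweR.
- by rewrite invr_ge0 ltW.
- by rewrite in_itv/= leey andbT nneseries_ge0// => k _ _; exact: poweR_ge0.
- by rewrite in_itv/= leey andbT nneseries_ge0// => k _ _; exact: poweR_ge0.
- apply: lee_nneseries => [n _ _|n _]; first exact: poweR_ge0.
  rewrite lee_fin /= normr_id ger0_norm ?addr_ge0//.
  rewrite ge0_ler_powR ?nnegrE ?addr_ge0 ?ler_normD//.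
  exact: ltW.
Qed.

Lemma lp_summableD y z :
  lp_summable y -> lp_summable z -> lp_summable (y + z).
Proof.
move=> cy cz; apply: lp_summableP; apply: le_lt_trans (NleD y z) _.
by rewrite !lp_normEN// -EFinD ltry.
Qed.

Lemma lp_normD y z : lp_summable y -> lp_summable z ->
  lp_norm (y + z) <= lp_norm y + lp_norm z.
Proof.
move=> cy cz; have := NleD y z.
by rewrite (lp_normEN (lp_summableD cy cz)) !lp_normEN// -EFinD lee_fin.
Qed.

Let powZ a y : (fun n => `|(a *: y) n| `^ p) =
  (`|a| `^ p) *: (fun n => `|y n| `^ p).
Proof. by apply/funext => n; rewrite /= !fctE normrZ powRM. Qed.

Lemma lp_summableZ a y : lp_summable y -> lp_summable (a *: y).
Proof. by move=> cy; rewrite /lp_summable powZ; exact: is_cvg_seriesZ. Qed.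

Lemma lp_normZ a y : lp_summable y -> lp_norm (a *: y) = `|a| * lp_norm y.
Proof.
move=> cy; rewrite /lp_norm powZ lim_seriesZ// powRM ?powR_ge0//.
  by rewrite -powRrM mulfV ?gt_eqF// powRr1.
by rewrite -lee_fin -sumE// nneseries_ge0// => n _ _; rewrite lee_fin powR_ge0.
Qed.

Lemma lp_summable0 : lp_summable 0.
Proof.
apply: lp_summableP; rewrite NE eseries0 ?poweR0r ?invr_neq0 ?gt_eqF//.
by move=> n _ _; rewrite normr0 powR0// gt_eqF.
Qed.

Lemma lp_norm0_eq0 y : lp_summable y -> lp_norm y = 0 -> y = 0.
Proof.
move=> cy /powR_eq0_eq0 s0; apply/funext => n; apply/normr0_eq0.
apply: (@powR_eq0_eq0 _ _ p); apply/eqP; rewrite eq_le powR_ge0 andbT -lee_fin.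
rewrite -[leRHS]/(0%:E) -s0 -sumE//.
have h k : (0%N <= k)%N -> true -> (0 <= (`|y k| `^ p)%:E)%E.
  by move=> _ _; rewrite lee_fin powR_ge0.
apply: le_trans (nneseries_lim_ge n.+1 h).
by rewrite big_nat_recr//= leeDr// sume_ge0// => k _; exact: h.
Qed.

(* The proof of [1 <= p] is a parameter because it is needed by the vector
   space structure below. *)
Definition lp_pred of 1 <= p : {pred nat -> Y} := mem [set y | lp_summable y].

Lemma lp_submod_closed : submod_closed (lp_pred p1).
Proof.
split=> [|a y z]; rewrite !inE; first exact: lp_summable0.
by move=> ? ?; apply: lp_summableD => //; exact: lp_summableZ.
Qed.

End LpSeq.
Arguments lp_pred {R p} Y p1.

HB.instance Definition _ (R : realType) (p : R) (Y : normedModType R)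
  (p1 : 1 <= p) := GRing.isSubmodClosed.Build R (nat -> Y) (lp_pred Y p1)
    (@lp_submod_closed R p Y p1).

Record lp (R : realType) (p : R) (p1 : 1 <= p) (Y : normedModType R) :=
  Lp { lp_seq :> nat -> Y; lp_seqP : lp_seq \in lp_pred Y p1 }.

Section LpNormed.
Context {R : realType} (p : R) (p1 : 1 <= p) (Y : normedModType R).

HB.instance Definition _ := [isSub for @lp_seq R p p1 Y].
HB.instance Definition _ := [Choice of lp p1 Y by <:].
HB.instance Definition _ := [SubChoice_isSubZmodule of lp p1 Y by <:].
HB.instance Definition _ := [SubZmodule_isSubLmodule of lp p1 Y by <:].

Let norm (y : lp p1 Y) : R := lp_norm p y.

Let summ (y : lp p1 Y) : lp_summable p y.
Proof. by have := lp_seqP y; rewrite inE. Qed.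

Let normD (x y : lp p1 Y) : norm (x + y) <= norm x + norm y.
Proof.
rewrite /norm -[lp_seq _]/(val _) raddfD/=.
exact: (lp_normD p1 (@summ x) (@summ y)).
Qed.

Let normZ a (x : lp p1 Y) : norm (a *: x) = `|a| * norm x.
Proof.
rewrite /norm -[lp_seq (a *: x)]/(val _) linearZ/=.
exact: (lp_normZ p1 a (@summ x)).
Qed.

Let norm0_eq0 x : norm x = 0 -> x = 0.
Proof. by move/(lp_norm0_eq0 (@summ x)) => x0; exact: val_inj. Qed.

HB.instance Definition _ :=
  Lmodule_isNormed.Build R (lp p1 Y) normD normZ norm0_eq0.

Lemma lp_normE (y : lp p1 Y) :
  `|y| = limn (series (fun n => `|y n| `^ p)) `^ p^-1.
Proof. by []. Qed.

Lemma lp_seqB (y z : lp p1 Y) : lp_seq (y - z) = lp_seq y - lp_seq z.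
Proof. by rewrite -[lp_seq (y - z)]/(val _) raddfB. Qed.

End LpNormed.

(* Main.v *)
Require Import Defs.
From HB Require Import structures.
From mathcomp Require Import all_boot all_order all_algebra.
From mathcomp Require Import all_classical all_reals all_analysis.
From mathcomp Require Import ring lra zify.

Import Order.TTheory GRing.Theory Num.Theory.
Import numFieldNormedType.Exports.

Local Open Scope ring_scope.

(** The idea is barycentric gluing with a separate coordinate for every scale.
  Fix [t0] in [X] and a unit vector [v] of [Y], and put
  [radius x = d (t0, x) + 1].  Let [f n] be the given map on the ball of radius
  [4 * 2 ^ n] around [t0], translated so that [f n t0 = 0], and let [weight n]
  be a function with values in [[0, 1]] of the radius, equal to 1 on
  [[2 ^ n, 2 * 2 ^ n]], vanishing outside [[2 ^ n / 2, 4 * 2 ^ n]], and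
  Lipschitz with constant [2 / 2 ^ n].  The embedding sends [x] to the sequence
  whose term of index 0 is [radius x *: v] and whose term of index [n + 1] is
  [weight n (radius x) *: f n x].

  Let the local maps have lower modulus [lo] and upper modulus [a * t + b].  On
  the ball of radius [4 * 2 ^ n], the norm of [f n] is
  of order [(a + b) * 2 ^ n], so changing the weight by moving from [x] to [y]
  costs at most [8 * (a + b) * |radius x - radius y|] ([weight_variation]).

  - Upper bound ([glue_upper]): every coordinate is coarsely Lipschitz, and a
    point has at most 4 nonzero coordinates, so that two images differ in at
    most 8 coordinates and their distance is at most 8 times the bound on one
    coordinate ([lp_norm_le]).
  - Lower bound ([glue_lower]): let [y] be the point of smaller radius and
    choose [n] with [weight n (radius x) = 1].  Both points lie in the domain
    of [f n], and the coordinate [n + 1] separates them by at least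
    [lo (d (x, y))] minus the variation of the weight, which is a multiple of
    [|radius x - radius y|], that is, of the distance in the coordinate 0.  So
    one of the two coordinates is bounded below by a fixed multiple of
    [lo (d (x, y))].

  The resulting moduli are a positive multiple of [lo] and an affine function,
  hence in the required classes.  When [Y] is trivial there is no unit vector;
  then [lo] is nonpositive on all distances and a constant map will do. *)

(** * Norm bounds for finitely supported sequences *)

Section LpBounds.
Context {R : realType} {p : R} {Y : normedModType R}.
Context (p1 : 1 <= p).
Implicit Type y : nat -> Y.

Let p0 : 0 < p. Proof. exact: lt_le_trans p1. Qed.

Lemma lp_summable_finite y (l : seq nat) :
  (forall n, y n != 0 -> n \in l) -> lp_summable p y.
Proof.
move=> yl; pose K := (\max_(i <- l) i).+1.
have y0 n : (K <= n)%N -> y n = 0.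
  move=> Kn; apply/eqP; apply: contraTT Kn => /yl nl.
  by rewrite -ltnNge ltnS; apply: (@leq_bigmax_seq _ _ _ id).
apply: (is_cvg_near_cst (series (fun n => `|y n| `^ p) K)); exists K => //.
move=> n /= Kn; apply/eqP; rewrite -subr_eq0 sub_series_geq//.
by rewrite big_nat big1// => i /andP[/y0 -> _]; rewrite normr0 powR0// gt_eqF.
Qed.

Lemma normr_le_lp_norm y n : lp_summable p y -> `|y n| <= lp_norm p y.
Proof.
move=> cy.
have mono : {homo series (fun n => `|y n| `^ p) : m k / (m <= k)%N >-> m <= k}.
  by apply: nondecreasing_series => k _ _; exact: powR_ge0.
have le : `|y n| `^ p <= limn (series (fun n => `|y n| `^ p)).
  apply: le_trans (nondecreasing_cvgn_le mono cy n.+1).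
  rewrite /series/= big_nat_recr//= lerDr.
  by apply: sumr_ge0 => *; exact: powR_ge0.
have -> : `|y n| = (`|y n| `^ p) `^ p^-1.
  by rewrite -powRrM mulfV ?gt_eqF// powRr1.
have le0 := le_trans (powR_ge0 _ _) le.
by apply: ge0_ler_powR => //; rewrite ?invr_ge0 ?nnegrE ?powR_ge0// ltW.
Qed.

Lemma lp_norm_le y (l : seq nat) M :
  (forall n, y n != 0 -> n \in l) -> (forall n, `|y n| <= M) ->
  lp_norm p y <= (size l)%:R * M.
Proof.
move=> yl yM; have M0 : 0 <= M := le_trans (normr_ge0 _) (yM 0%N).
have cy := lp_summable_finite _ _ yl.
have lim_le : limn (series (fun n => `|y n| `^ p)) <= ((size l)%:R * M) `^ p.
  apply: limr_le => //; apply: nearW => n.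
  apply: (@le_trans _ _ ((size l)%:R * M `^ p)); last first.
    (* [k <= k ^ p] for every natural number [k], because [1 <= p]. *)
    rewrite powRM// ler_wpM2r ?powR_ge0//.
    case: (size l) => [|k]; first by rewrite powR_ge0.
    by rewrite -[leLHS]powRr1// ler_powR ?ler1n.
  rewrite /series/= (bigID (mem l))/= [X in _ + X]big1 ?addr0; last first.
    move=> i il; case: eqVneq (yl i) il => [->|_ ->//].
    by rewrite normr0 powR0// gt_eqF.
  rewrite -big_filter; set s := (X in \sum_(i <- X) _).
  apply: (@le_trans _ _ (\sum_(i <- s) M `^ p)).
    by apply: ler_sum => i _; apply: (ge0_ler_powR (ltW p0)); rewrite ?nnegrE ?yM.
  rewrite big_const_seq count_predT iter_addr_0 -[leLHS]mulr_natl.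
  rewrite ler_wpM2r ?powR_ge0// ler_nat; apply: uniq_leq_size.
    by rewrite filter_uniq// iota_uniq.
  by move=> i; rewrite mem_filter => /andP[].
have -> : (size l)%:R * M = (((size l)%:R * M) `^ p) `^ p^-1.
  by rewrite -powRrM mulfV ?gt_eqF// powRr1// mulr_ge0.
have lim0 : 0 <= limn (series (fun n => `|y n| `^ p)).
  apply: limr_ge => //; apply: nearW => n.
  by apply: sumr_ge0 => *; exact: powR_ge0.
by apply: ge0_ler_powR => //; rewrite ?invr_ge0 ?nnegrE ?powR_ge0// ltW.
Qed.

End LpBounds.

(** * Weights attached to dyadic scales *)

Section DyadicWeights.
Context {R : realType}.
Implicit Types (r s t : R) (n k N : nat).

(** The piecewise affine function equal to 1 on [[1, 2]] and to 0 outside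
  [[1 / 2, 4]]. *)
Definition bump s : R :=
  Num.max 0 (Num.min 1 (Num.min (2 * s - 1) (2 - s / 2))).

(** The bump function at scale [2 ^ n]. *)
Definition weight n r : R := bump (r / 2 ^+ n).

Lemma weight_ge0 n r : 0 <= weight n r.
Proof. by rewrite le_max lexx. Qed.

Lemma weight_le1 n r : weight n r <= 1.
Proof. by rewrite ge_max ler01 ge_min lexx. Qed.

Lemma bump_lipschitz s t : `|bump s - bump t| <= 2 * `|s - t|.
Proof.
wlog st : s t / bump t <= bump s.
  move=> H; have [/H//|/ltW/H] := leP (bump t) (bump s).
  by rewrite distrC [`|t - s|]distrC.
rewrite ger0_norm ?subr_ge0// lerBlDr {st}.
have := ler_norm (s - t); have := ler_norm (t - s); rewrite distrC => ts st'.
rewrite {1}/bump ge_max; apply/andP; split.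
  by rewrite addr_ge0 ?mulr_ge0// le_max lexx.
rewrite -lerBlDl /bump le_max; apply/orP; right.
set m := Num.min 1 _.
have : m <= m by []; rewrite {2}/m !le_min => /and3P[m1 m2 m3].
by apply/and3P; split; lra.
Qed.

Lemma weight_lipschitz n r s :
  `|weight n r - weight n s| <= 2 * `|r - s| / 2 ^+ n.
Proof.
apply: le_trans (bump_lipschitz _ _) _.
by rewrite -mulrBl normrM mulrA [`|_^-1|]gtr0_norm ?invr_gt0 ?exprn_gt0.
Qed.

Lemma weight_neq0 n r : weight n r != 0 -> (2 ^+ n < 2 * r) && (r < 4 * 2 ^+ n).
Proof.
have n0 : 0 < 2 ^+ n :> R by rewrite exprn_gt0.
move=> w0; have : 0 < weight n r by rewrite lt_def w0 weight_ge0.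
rewrite /weight /bump lt_max ltxx/= !lt_min => /and3P[_ h1 h2].
have {h1} h1 : 1 / 2 < r / 2 ^+ n by lra.
have {h2} h2 : r / 2 ^+ n < 4 by lra.
move: h1 h2; rewrite ltr_pdivlMr// ltr_pdivrMr// => h1 ->.
by rewrite andbT; lra.
Qed.

Lemma weight_eq1 n r : 2 ^+ n <= r <= 2 * 2 ^+ n -> weight n r = 1.
Proof.
have n0 : 0 < 2 ^+ n :> R by rewrite exprn_gt0.
rewrite -{1}[2 ^+ n]mul1r -(ler_pdivlMr _ _ n0) -(ler_pdivrMr _ _ n0).
move=> /andP[h1 h2].
rewrite /weight /bump; move: (r / _) h1 h2 => s h1 h2.
by rewrite min_l ?max_r// le_min; apply/andP; split; lra.
Qed.

Lemma dyadic_scale r : 1 <= r -> exists N, 2 ^+ N <= r < 2 * 2 ^+ N.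
Proof.
move=> r1; have : exists N, r < 2 ^+ N.
  exists (Num.bound r); apply: lt_le_trans (archi_boundP _) _.
    exact: le_trans r1.
  by rewrite -natrX ler_nat ltnW// ltn_expl.
case/ex_minnP => -[|N]; first by rewrite expr0 ltNge r1.
rewrite exprS => rN minN; exists N; rewrite rN andbT leNgt.
by apply/negP => /minN; rewrite ltnn.
Qed.

(** At most three weights are nonzero at a given radius.  When [N = 0] the list
  has a repetition, which is harmless. *)
Lemma weight_support r : 1 <= r -> exists N,
  forall n, weight n r != 0 -> n \in [:: N.-1; N; N.+1].
Proof.
move=> /dyadic_scale[N /andP[Nr rN]]; exists N => n /weight_neq0/andP[nr rn].
have two1 : 1 < 2 :> R by rewrite ltr1n.
have : 2 ^+ n < 2 ^+ N.+2 :> R by rewrite 2!exprS; lra.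
have : 2 ^+ N < 2 ^+ n.+2 :> R by rewrite 2!exprS; lra.
rewrite !ltr_eXn2l// !inE; lia.
Qed.

End DyadicWeights.

(** * Moduli up to equivalence *)

Section AsympLemmas.
Context {R : realType}.
Implicit Types (g h : R -> R) (a b c : R).

Lemma asymp_nneg_scale g h c : 0 < c ->
  asymp_nneg g h -> asymp_nneg (fun t => c * g t) h.
Proof.
move=> c0 [[a1 [a2 [a3 [a4 [a10 a20 gh]]]]] [b1 [b2 [b3 [b4 [b10 b20 hg]]]]]].
split.
- exists (c * a1), a2, a3, (c * a4); split=> // [|t]; first exact: mulr_gt0.
  by rewrite /extend_cst -mulrA -mulrDr ler_pM2l//; exact: gh.
- exists (b1 / c), b2, b3, b4; split=> // [|t]; first exact: divr_gt0.
  by rewrite /extend_cst mulrA divfK ?gt_eqF//; exact: hg.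
Qed.

Lemma asymp_nneg_affine a b : 0 < a ->
  asymp_nneg (fun t => a * t + b) (fun t => t).
Proof.
move=> a0; split.
- by exists a, 1, 0, b; split=> // t; rewrite /extend_cst mul1r addr0.
- exists a^-1, 1, 0, (- (b / a)); split=> // [|t]; first by rewrite invr_gt0.
  rewrite /extend_cst mul1r addr0 mulrDr mulKf ?gt_eqF//.
  by rewrite [a^-1 * b]mulrC addrK.
Qed.

Lemma asymp_nneg_id_le g : asymp_nneg g (fun t => t) ->
  exists a b : R, [/\ 0 <= a, 0 <= b & forall t, 0 <= t -> g t <= a * t + b].
Proof.
move=> [[c1 [c2 [c3 [c4 [c10 c20 H]]]]] _].
exists (c1 * c2), (c1 * `|c3| + `|c4|); split.
- by rewrite mulr_ge0 ?ltW.
- by rewrite addr_ge0// mulr_ge0// ltW.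
move=> t t0; have := H t; rewrite /extend_cst max_r// => /le_trans; apply.
rewrite addrA -mulrA -mulrDr lerD ?ler_norm// ler_pM2l// ge_max.
apply/andP; split; last by rewrite lerD2l ler_norm.
by rewrite addr_ge0// mulr_ge0// ltW.
Qed.

End AsympLemmas.

(** * Gluing local maps *)

Lemma mdist_lp (R : realType) (p : R) (p1 : 1 <= p) (Y : normedModType R)
    (y z : norm_metric (lp p1 Y)) :
  mdist y z = lp_norm p (fun n => (y : lp p1 Y) n - (z : lp p1 Y) n).
Proof. by rewrite mdist_normE [LHS]lp_normE lp_seqB. Qed.

Section LocalMaps.
Context {R : realType} {X : metricType R} {Y : normedModType R}.

(** A map defined on a ball around [t0] can be translated to vanish at [t0],
  and is extended by 0 to a map on the whole space. *)
Lemma based_local_map (lo up : R -> R) (t0 : X) (r : R) : 0 < r ->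
  (forall B : set X, metric_ball B ->
    exists f : B -> norm_metric Y, forall x y : B,
      lo (mdist (val x) (val y)) <= mdist (f x) (f y)
        <= up (mdist (val x) (val y))) ->
  exists f : X -> Y, [/\ f t0 = 0, forall x, r <= mdist t0 x -> f x = 0 &
    forall x y, mdist t0 x < r -> mdist t0 y < r ->
      lo (mdist x y) <= `|f x - f y| <= up (mdist x y)].
Proof.
move=> r0 /(_ (ball t0 r))[|f fP]; first by exists t0, r.
have inB x : mdist t0 x < r -> x \in (ball t0 r : set X).
  by move=> xr; rewrite inE ballEmdist.
have t0r : mdist t0 t0 < r by rewrite mdistxx.
pose F (x : X) : Y := match pselect (mdist t0 x < r) with
  | left xr => (f (exist _ x (inB x xr)) : Y) - f (exist _ t0 (inB t0 t0r))
  | right _ => 0 end.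
exists F; split.
- rewrite /F; case: pselect => // h.
  by rewrite (Prop_irrelevance h t0r) subrr.
- move=> x rx; rewrite /F; case: pselect => // h.
  by have := lt_le_trans h rx; rewrite ltxx.
- move=> x y xr yr; rewrite /F; case: pselect => // h; case: pselect => // k.
  have := fP (exist _ x (inB x h)) (exist _ y (inB y k)).
  by rewrite mdist_normE/= opprB addrA subrK.
Qed.

End LocalMaps.

Section Gluing.
Context {R : realType} {X : metricType R} {Y : normedModType R}.
Context {p : R} (p1 : 1 <= p) (t0 : X) (v : Y) (f : nat -> X -> Y).
Context (lo : R -> R) (a b : R).
Context (v1 : `|v| = 1) (a0 : 0 <= a) (b0 : 0 <= b).
Context (f_base : forall n, f n t0 = 0).
Context (f_out : forall n x, 4 * 2 ^+ n <= mdist t0 x -> f n x = 0).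
Context (f_lo : forall n x y, mdist t0 x < 4 * 2 ^+ n ->
  mdist t0 y < 4 * 2 ^+ n -> lo (mdist x y) <= `|f n x - f n y|).
Context (f_up : forall n x y, mdist t0 x < 4 * 2 ^+ n ->
  mdist t0 y < 4 * 2 ^+ n -> `|f n x - f n y| <= a * mdist x y + b).

Let pow_ge1 n : 1 <= 2 ^+ n :> R.
Proof. by rewrite exprn_ege1// ler1n. Qed.

(** The distance to the base point, shifted by 1 to make it at least [2 ^ 0],
  so that natural exponents suffice for the scales. *)
Definition radius x : R := mdist t0 x + 1.

Lemma radius_ge1 x : 1 <= radius x.
Proof. by rewrite lerDr mdist_ge0. Qed.

Lemma radius_lipschitz x y : `|radius x - radius y| <= mdist x y.
Proof.
rewrite /radius; have := metric_triangle t0 x y.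
have := metric_triangle t0 y x; rewrite (metric_sym y x) => h1 h2.
by rewrite ler_norml; apply/andP; split; lra.
Qed.

Lemma weight_radius_out n x :
  4 * 2 ^+ n <= mdist t0 x -> weight n (radius x) = 0.
Proof.
move=> h; apply/eqP; apply: contraTT h => /weight_neq0/andP[_].
by rewrite -ltNge /radius => ?; lra.
Qed.

(** The contribution of scale [n]. *)
Definition piece n x : Y := weight n (radius x) *: f n x.

(* 8 is the product of the constant 2 in [weight_lipschitz] and the relative
   size 4 of the balls. *)
Let K := 8 * (a + b).

(** As [f n] vanishes at [t0], its norm on the ball of radius [4 * 2 ^ n] is of
  order [2 ^ n], which compensates for the Lipschitz constant of the weight. *)
Lemma weight_variation n x y :
  `|(weight n (radius x) - weight n (radius y)) *: f n y|
    <= K * `|radius x - radius y|.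
Proof.
have n0 : 0 < 2 ^+ n :> R by rewrite exprn_gt0.
have [yn|yn] := ltP (mdist t0 y) (4 * 2 ^+ n); last first.
  by rewrite f_out// scaler0 normr0 !mulr_ge0 ?addr_ge0.
have fy : `|f n y| <= 4 * 2 ^+ n * (a + b).
  rewrite -[f n y]subr0 -(f_base n).
  have t0n : mdist t0 t0 < 4 * 2 ^+ n by rewrite mdistxx mulr_gt0.
  apply: le_trans (f_up n y t0 yn t0n) _; rewrite metric_sym mulrDr.
  have := ler_wpM2l a0 (ltW yn); have := ler_wpM2r b0 (pow_ge1 n).
  have := mulr_ge0 (ltW n0) b0; lra.
rewrite normrZ; apply: le_trans (ler_pM _ _ (weight_lipschitz _ _ _) fy) _ => //.
rewrite le_eqVlt; apply/orP; left; apply/eqP.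
by rewrite /K; field; rewrite gt_eqF.
Qed.

Lemma piece_upper n x y :
  `|piece n x - piece n y| <= (a + K) * mdist x y + b.
Proof.
have d0 := mdist_ge0 x y.
have K0 : 0 <= K by rewrite mulr_ge0// addr_ge0.
have rK : K * `|radius x - radius y| <= K * mdist x y.
  by rewrite ler_wpM2l// radius_lipschitz.
have ab0 : 0 <= a * mdist x y + b by rewrite addr_ge0// mulr_ge0.
have split_piece : piece n x - piece n y =
    weight n (radius x) *: (f n x - f n y) +
    (weight n (radius x) - weight n (radius y)) *: f n y.
  by rewrite scalerBr scalerBl addrA subrK.
(* Outside the ball the weight is 0, and only its variation contributes. *)
have [xn|xn] := ltP (mdist t0 x) (4 * 2 ^+ n); last first.
  rewrite split_piece [X in X *: _ + _]weight_radius_out// scale0r add0r.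
  apply: le_trans (weight_variation _ _ _) _; lra.
have [yn|yn] := ltP (mdist t0 y) (4 * 2 ^+ n); last first.
  have -> : piece n x - piece n y =
      - ((weight n (radius y) - weight n (radius x)) *: f n x).
    by rewrite /piece (weight_radius_out n y yn) scale0r subr0 sub0r scaleNr opprK.
  rewrite normrN; apply: le_trans (weight_variation _ _ _) _.
  rewrite distrC; lra.
rewrite split_piece; apply: le_trans (ler_normD _ _) _.
have := weight_variation n x y.
have : `|weight n (radius x) *: (f n x - f n y)| <= a * mdist x y + b.
  apply: le_trans (f_up n x y xn yn); rewrite normrZ ger0_norm ?weight_ge0//.
  by rewrite ler_piMl// weight_le1.
lra.
Qed.

(** The piece whose weight is 1 at the point of larger radius separates the two
  points as well as [f n] does, up to the variation of the weight. *)
Lemma piece_lower n x y : radius y <= radius x ->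
  2 ^+ n <= radius x < 2 * 2 ^+ n ->
  lo (mdist x y) <= `|piece n x - piece n y| + K * `|radius x - radius y|.
Proof.
have n0 : 0 < 2 ^+ n :> R by rewrite exprn_gt0.
move=> yx /andP[nx xn].
have xB : mdist t0 x < 4 * 2 ^+ n by move: xn; rewrite /radius => ?; lra.
have yB : mdist t0 y < 4 * 2 ^+ n by move: xn yx; rewrite /radius => ? ?; lra.
apply: le_trans (f_lo n x y xB yB) _.
apply: le_trans (lerD (lexx _) (weight_variation n x y)).
have -> : f n x - f n y = (piece n x - piece n y) -
    (weight n (radius x) - weight n (radius y)) *: f n y.
  rewrite /piece weight_eq1 ?nx ?ltW// scalerBl !scale1r.
  by rewrite opprB addrA subrK.
exact: ler_normB.
Qed.

(** The radius along [v], followed by the pieces of all scales. *)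
Definition glue_seq x : nat -> Y :=
  fun n => if n is k.+1 then piece k x else radius x *: v.

Lemma glue_seq_support x : exists l : seq nat,
  size l = 4%N /\ forall n, glue_seq x n != 0 -> n \in l.
Proof.
have [N NP] := weight_support _ (radius_ge1 x).
exists [:: 0; N.-1.+1; N.+1; N.+2]%N; split=> // -[//|n] /= gn.
suff /NP : weight n (radius x) != 0 by rewrite !inE !eqSS.
by apply: contraNneq gn; rewrite /piece => ->; rewrite scale0r.
Qed.

Lemma glue_seq_mem x : glue_seq x \in lp_pred Y p1.
Proof.
by have [l [_ lP]] := glue_seq_support x; rewrite inE; exact: (lp_summable_finite p1 _ _ lP).
Qed.

(** The glued map into [lp]. *)
Definition glue x : lp p1 Y := Lp (glue_seq_mem x).

Lemma glue_upper x y :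
  lp_norm p (fun n => glue x n - glue y n) <= 8 * ((1 + a + K) * mdist x y + b).
Proof.
have [[l [sl lP]] [m [sm mP]]] := (glue_seq_support x, glue_seq_support y).
have -> : 8 = (size (l ++ m))%:R :> R by rewrite size_cat sl sm.
have d0 := mdist_ge0 x y.
apply: lp_norm_le => // [n|[|n]] /=.
- rewrite mem_cat => xy; apply/orP.
  have [x0|/lP] := eqVneq (glue_seq x n) 0; last by left.
  have [y0|/mP] := eqVneq (glue_seq y n) 0; last by right.
  by rewrite x0 y0 subrr eqxx in xy.
- rewrite -scalerBl normrZ v1 mulr1; apply: le_trans (radius_lipschitz x y) _.
  have : 0 <= (a + K) * mdist x y by rewrite !(mulr_ge0, addr_ge0).
  by move: b0; lra.
- by apply: le_trans (piece_upper n x y) _; lra.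
Qed.

Lemma glue_lower x y :
  lo (mdist x y) <= (1 + K) * lp_norm p (fun n => glue x n - glue y n).
Proof.
wlog yx : x y / radius y <= radius x.
  move=> H; have [/H//|/ltW/H] := leP (radius y) (radius x).
  rewrite metric_sym => /le_trans; apply; rewrite le_eqVlt; apply/orP; left.
  apply/eqP; congr (_ * (limn (series _) `^ _)).
  by apply/funext => n; rewrite distrC.
have [N xN] := dyadic_scale _ (radius_ge1 x).
have sm : lp_summable p (fun n => glue x n - glue y n).
  have := lp_seqP (glue x - glue y); rewrite inE lp_seqB; exact.
have K0 : 0 <= K by rewrite mulr_ge0// addr_ge0.
have := normr_le_lp_norm p1 _ N.+1 sm.
have := normr_le_lp_norm p1 _ 0 sm.
rewrite /= -scalerBl normrZ v1 mulr1 => /(ler_wpM2l K0) h0 h1.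
have := piece_lower N x y yx xN; lra.
Qed.

End Gluing.

Theorem theorem4 (R : realType) (p : R) (p1 : 1 <= p) (rho : R -> R)
    (rho_ge0 : forall t : R, 0 <= t -> 0 <= rho t)
    (rho_nd : nondecreasing_nneg rho)
    (X : metricType R) (Y : completeNormedModType R) :
  locally_representable X (norm_metric Y) rho (fun t => t) ->
  admits_embedding X (norm_metric (lp p1 Y)) rho (fun t => t).
Proof.
move=> [lo [up [[lo_nd lo_rho] [up_nd up_id] loc]]].
have ball_gt0 n : 0 < 4 * 2 ^+ n :> R by rewrite mulr_gt0// exprn_gt0.
have loc_at (t0 : X) n := based_local_map lo up t0 (4 * 2 ^+ n) (ball_gt0 n) loc.
(* If [Y] is trivial, every local map is constant, so [lo] is nonpositive on
   distances and the zero map is an embedding with the same moduli. *)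
have [[v v0]|Y0] := pselect (exists v : Y, v != 0); last first.
  have {}Y0 (v : Y) : v = 0.
    by apply: contra_notP Y0 => /eqP; exists v.
  exists (fun=> 0), lo, up; split=> // x y; rewrite mdistxx.
  have [|f [_ _ fP]] := based_local_map lo up x (mdist x y + 1) _ loc.
    by rewrite ltr_wpDl ?mdist_ge0.
  have := fP x y; rewrite (Y0 (f x)) (Y0 (f y)) subrr normr0; apply.
    by rewrite mdistxx ltr_wpDl ?mdist_ge0.
  by rewrite ltrDl.
have [a [b [a0 b0 up_le]]] := asymp_nneg_id_le _ up_id.
have [[t0 _]|X0] := pselect (exists t0 : X, True); last first.
  by exists (fun=> 0), lo, up; split=> // x; exfalso; apply: X0; exists x.
have [f fP] := choice (loc_at t0).
pose u := `|v|^-1 *: v.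
have u1 : `|u| = 1.
  by rewrite normrZ normfV normr_id mulVf// normr_eq0.
have f_up n x y : mdist t0 x < 4 * 2 ^+ n -> mdist t0 y < 4 * 2 ^+ n ->
    `|f n x - f n y| <= a * mdist x y + b.
  move=> xn yn; have [_ _ /(_ x y xn yn)/andP[_ h]] := fP n.
  exact: le_trans h (up_le _ (mdist_ge0 _ _)).
have f_lo n x y : mdist t0 x < 4 * 2 ^+ n -> mdist t0 y < 4 * 2 ^+ n ->
    lo (mdist x y) <= `|f n x - f n y|.
  by move=> xn yn; have [_ _ /(_ x y xn yn)/andP[]] := fP n.
have f_base n : f n t0 = 0 by have [] := fP n.
have f_out n x : 4 * 2 ^+ n <= mdist t0 x -> f n x = 0.
  by have [_ + _] := fP n; exact.
pose K := 8 * (a + b).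
have K1 : 0 < 1 + K by rewrite ltr_wpDr// mulr_ge0// addr_ge0.
have aK : 0 < 1 + a + K by rewrite addrAC ltr_wpDr.
exists (glue p1 t0 u f), (fun t => (1 + K)^-1 * lo t),
  (fun t => 8 * (1 + a + K) * t + 8 * b); split.
- split; last by apply: asymp_nneg_scale lo_rho; rewrite invr_gt0.
  by move=> s t s0 t0' st; rewrite ler_pM2l ?invr_gt0//; exact: lo_nd.
- split; last by apply: asymp_nneg_affine; rewrite mulr_gt0.
  by move=> s t _ _ st; rewrite lerD2r ler_pM2l// mulr_gt0.
- move=> x y; rewrite mdist_lp; apply/andP; split.
    by rewrite -ler_pdivlMl ?invr_gt0// invrK; exact: glue_lower.
  by rewrite -mulrA -mulrDr; exact: glue_upper.
Qed.
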